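(* Let $(X,d)$ be a metric space, let $p \in X$ be a fixed point, and let $Y$ and $Z$ be unbounded subspaces of $(X,d)$. Then $Y$ and $Z$ are strongly asymptotically equivalent if and only if $$\lim_{t\to\infty} \frac{\varepsilon(t)}{t} = 0 .$$
   Context: A scaling sequence is a sequence $\tilde r=(r_n)_{n\in\mathbb N}$ of positive real numbers with $\lim_{n\to\infty} r_n=\infty$. For an unbounded subspace $A$ of $(X,d)$, $Seq(A,\tilde r)$ is the set of all sequences $\tilde a=(a_n)_{n\in\mathbb N}$ of points of $A$ for which the limit $\lim_{n\to\infty} d(a_n,p)/r_n$ exists and is finite (this does not depend on the choice of the point $p$). On $Seq(X,\tilde r)$ define the pseudometric $d^{\tilde r}(\tilde x,\tilde y)=\limsup_{n\to\infty} d(x_n,y_n)/r_n$. Unbounded subspaces $Y,Z$ of $(X,d)$ are asymptotically equivalent with respect to $\tilde r$ if there are mappings $\mathbf\Phi: Seq(Y,\tilde r)\to Seq(Z,\tilde r)$ and $\mathbf\Psi: Seq(Z,\tilde r)\to Seq(Y,\tilde r)$ such that $d^{\tilde r}(\tilde y,\mathbf\Phi(\tilde y))=0=d^{\tilde r}(\tilde z,\mathbf\Psi(\tilde z))$ for every $\tilde y\in Seq(Y,\tilde r)$ and every $\tilde z\in Seq(Z,\tilde r)$. They are strongly asymptotically equivalent if they are asymptotically equivalent with respect to every scaling sequence $\tilde r$. For $t>0$ and $A\subseteq X$ put $S_t^A=\{x\in A: d(x,p)=t\}$. Define $$\varepsilon(t,Z,Y)=\sup_{z\in S_t^Z}\inf_{y\in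 Y} d(z,y),\qquad \varepsilon(t,Y,Z)=\sup_{y\in S_t^Y}\inf_{z\in Z} d(y,z),$$ with $\varepsilon(t,Z,Y)=0$ if $S_t^Z=\varnothing$ and $\varepsilon(t,Y,Z)=0$ if $S_t^Y=\varnothing$, and $\varepsilon(t)=\max\{\varepsilon(t,Z,Y),\varepsilon(t,Y,Z)\}$. *)

(* Defs.v *)
From mathcomp Require Import all_boot all_order all_algebra.
From mathcomp Require Import all_classical all_reals all_analysis.

Set Implicit Arguments.
Unset Strict Implicit.
Unset Printing Implicit Defensive.

Import Order.TTheory GRing.Theory Num.Theory.
Import numFieldNormedType.Exports.

Local Open Scope classical_set_scope.
Local Open Scope ring_scope.

Section AsymptoticEquivalence.
Context {R : realType} {X : metricType R}.
Implicit Types (p : X) (A Y Z : set X) (r : nat -> R) (t : R).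

(* Infinite diameter. *)
Definition unbounded A :=
  forall M : R, exists x y, [/\ A x, A y & M < mdist x y].

Definition scaling_sequence r :=
  (forall n, 0 < r n) /\ r n @[n --> \oo] --> +oo.

(* The limit is taken in [R], so [cvg] means that it exists and is finite. *)
Definition Seq p A r : set (nat -> X) :=
  [set a | (forall n, A (a n)) /\ cvg (mdist (a n) p / r n @[n --> \oo])].

Definition seq_dist r (x y : nat -> X) : \bar R :=
  limn_esup (fun n => (mdist (x n) (y n) / r n)%:E).

(* A mapping Seq(Y, r) -> Seq(Z, r) is rendered by a total function on
   sequences that sends the first set into the second. *)
Definition asymptotically_equivalent p Y Z r :=
  exists Phi Psi : (nat -> X) -> (nat -> X),
    [/\ set_fun (Seq p Y r) (Seq p Z r) Phi,
        set_fun (Seq p Z r) (Seq p Y r) Psi,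
        forall y, Seq p Y r y -> seq_dist r y (Phi y) = 0%E &
        forall z, Seq p Z r z -> seq_dist r z (Psi z) = 0%E].

Definition strongly_asymptotically_equivalent p Y Z :=
  forall r, scaling_sequence r -> asymptotically_equivalent p Y Z r.

Definition sphere_in p t A : set X := [set x | A x /\ mdist x p = t].

(* [excess p t Z Y] is epsilon(t, Z, Y). The real-valued [sup] satisfies
   [sup set0 = 0], which is the convention for an empty sphere. For nonempty Y
   the set is bounded above, by t + d(p, y) for any y in Y, so [sup] and [inf]
   are genuine bounds. *)
Definition excess p t Z Y : R :=
  sup [set inf [set mdist z y | y in Y] | z in sphere_in p t Z].

Definition epsilon p Y Z t : R := Num.max (excess p t Z Y) (excess p t Y Z).

End AsymptoticEquivalence.

(* Main.v *)
Require Import Defs.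
From mathcomp Require Import all_boot all_order all_algebra.
From mathcomp Require Import all_classical all_reals all_analysis.
From mathcomp Require Import lra.

Import Order.TTheory GRing.Theory Num.Theory.
Import numFieldNormedType.Exports.

Local Open Scope classical_set_scope.
Local Open Scope ring_scope.

(** Both conditions split into two one-sided halves, exchanged by swapping [Y] and [Z]
    ([asymptotically_equivalentE], [epsilon_cvg0E]), so it suffices to compare [approximable] for
    all scalings with [excess p t Y Z / t] tending to 0. If the excess is o(t), points y_n of a
    sequence in [Seq p Y r] lie within o(r_n) of [Z], because d(y_n, p) = O(r_n) and r_n tends to
    infinity ([excess_cvg0_approximable]). Conversely, radii where the ratio stays away from 0
    themselves form a scaling sequence that defeats approximation ([approximable_excess_cvg0]). *)

Lemma unbounded_nonempty (R : realType) (X : metricType R) (A : set X) :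
  unbounded A -> A !=set0.
Proof. by move=> /(_ 0)[x [_ [Ax _ _]]]; exists x. Qed.

Section PointToSet.
Context {R : realType} {X : metricType R}.
Implicit Types (p x y : X) (A Y Z : set X) (t : R).

Lemma inf_mdist_ge0 x A : 0 <= inf [set mdist x a | a in A].
Proof.
have [->|A0] := eqVneq A set0; first by rewrite image_set0 inf0.
apply: lb_le_inf; first by apply/image_nonempty/set0P.
by move=> _ [a _ <-]; exact: mdist_ge0.
Qed.

Lemma inf_mdist_le x a A : A a -> inf [set mdist x y | y in A] <= mdist x a.
Proof.
move=> Aa; apply: ge_inf; last by exists a.
by exists 0 => _ [b _ <-]; exact: mdist_ge0.
Qed.

Lemma excess_ge0 p t Y Z : 0 <= excess p t Y Z.
Proof.
rewrite /excess; set E := (X in sup X).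
(* When [E] is empty or unbounded above, [sup E] takes the default value 0. *)
have [[[e Ee] ubE]|/sup_out ->//] := pselect (has_sup E).
apply: le_trans (ub_le_sup ubE Ee).
by case: Ee => y _ <-; exact: inf_mdist_ge0.
Qed.

Lemma inf_mdist_le_excess p y Y Z : Z !=set0 -> Y y ->
  inf [set mdist y z | z in Z] <= excess p (mdist y p) Y Z.
Proof.
move=> [a Za] Yy; apply: ub_le_sup; last by exists y.
exists (mdist y p + mdist p a) => _ [x [_ xp] <-].
by rewrite (le_trans (inf_mdist_le x a Z Za))// -xp metric_triangle.
Qed.

Lemma excess_gt p t e Y Z : 0 <= e -> e < excess p t Y Z ->
  exists y, [/\ Y y, mdist y p = t & forall z, Z z -> e < mdist y z].
Proof.
rewrite /excess; set E := (X in sup X) => e0 eE.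
(* An empty sphere would give excess 0, which cannot exceed [e]. *)
have E0 : E !=set0.
  by apply/set0P/eqP => E0; move: eE; rewrite E0 sup0 ltNge e0.
have [_ [y [Yy yp] <-] ey] := sup_gt E0 eE.
exists y; split => // z Zz; exact: lt_le_trans ey (inf_mdist_le y z Z Zz).
Qed.

End PointToSet.

Section OneSided.
Context {R : realType} {X : metricType R}.
Implicit Types (p : X) (Y Z : set X) (r : nat -> R).

(** The terms are nonnegative, so a zero limsup forces convergence to 0. *)
Lemma seq_dist_eq0 r (x y : nat -> X) : (forall n, 0 < r n) ->
  seq_dist r x y = 0%E <-> mdist (x n) (y n) / r n @[n --> \oo] --> (0 : R).
Proof.
move=> r0; split=> xy0.
  apply: (@fine_cvg _ _ _ _ (fun n => (mdist (x n) (y n) / r n)%:E)).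
  apply: limn_esup_le_cvg => [|n]; first by rewrite -/(seq_dist _ _ _) xy0.
  by rewrite lee_fin divr_ge0 ?mdist_ge0// ltW.
rewrite /seq_dist; apply: (cvg_limn_einf_sup _).2.
by apply: cvg_EFin => //; exact: nearW.
Qed.

(** By the triangle inequality d(y_n, p) and d(z_n, p) differ by at most d(y_n, z_n) = o(r_n), so
    both ratios have the same limit. *)
Lemma Seq_close p Y Z r (y z : nat -> X) : (forall n, 0 < r n) ->
  Seq p Y r y -> (forall n, Z (z n)) ->
  mdist (y n) (z n) / r n @[n --> \oo] --> (0 : R) -> Seq p Z r z.
Proof.
move=> r0 [_ /cvg_ex[l yl]] Zz yz0; split=> //; apply/cvg_ex; exists l => /=.
rewrite -(subr0 l).
have -> : (fun n => mdist (z n) p / r n) =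
    (fun n => mdist (y n) p / r n - (mdist (y n) p / r n - mdist (z n) p / r n)).
  by apply/funext => n; rewrite subKr.
apply: cvgB => //; apply/norm_cvg0P.
apply: squeeze_cvgr (cvg_cst 0) yz0; apply: nearW => n /=.
rewrite normr_ge0 -mulrBl normrM (gtr0_norm (_ : 0 < (r n)^-1)) ?invr_gt0//.
rewrite ler_pM2r ?invr_gt0// ler_distl.
have := metric_triangle (y n) (z n) p.
have := metric_triangle (z n) (y n) p.
rewrite (metric_sym (z n) (y n)) => *; lra.
Qed.

Definition approximable p Y Z r := forall y, Seq p Y r y ->
  exists2 z, Seq p Z r z & seq_dist r y z = 0%E.

(** The maps [Phi] and [Psi] carry no structure, so choice recovers them from pointwise
    approximation. *)
Lemma asymptotically_equivalentE p Y Z r :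
  asymptotically_equivalent p Y Z r <->
  approximable p Y Z r /\ approximable p Z Y r.
Proof.
split=> [[Phi [Psi [YZ ZY yPhi zPsi]]]|[YZ ZY]].
  split=> [y Yy|z Zz].
    by exists (Phi y); [exact: YZ|exact: yPhi].
  by exists (Psi z); [exact: ZY|exact: zPsi].
have total A B : approximable p A B r -> exists f : (nat -> X) -> nat -> X,
    forall x, Seq p A r x -> Seq p B r (f x) /\ seq_dist r x (f x) = 0%E.
  move=> AB; suff [f fP] : {f : (nat -> X) -> nat -> X & forall x,
      Seq p A r x -> Seq p B r (f x) /\ seq_dist r x (f x) = 0%E} by exists f.
  apply: (choice (P := fun x y => Seq p A r x ->
    Seq p B r y /\ seq_dist r x y = 0%E)) => x.
  (* Outside [Seq p A r] the value is irrelevant; [x] itself is used. *)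
  by have [/AB[y]|] := pselect (Seq p A r x); [exists y|exists x].
have [Phi PhiP] := total _ _ YZ; have [Psi PsiP] := total _ _ ZY.
by exists Phi, Psi; split=> x /[dup] ? => [/PhiP[]|/PsiP[]|/PhiP[]|/PsiP[]].
Qed.

(* Take z_n in Z within 1 of the distance from y_n to Z. That distance is at most
   d * d(y_n, p) once d(y_n, p) is large, and bounded otherwise, so that
   d(y_n, z_n) <= d * d(y_n, p) + C in all cases. *)
Lemma excess_cvg0_approximable p Y Z r : Z !=set0 -> scaling_sequence r ->
  excess p t Y Z / t @[t --> +oo] --> (0 : R) -> approximable p Y Z r.
Proof.
move=> Z0 [r0 roo] /cvgr0Pnorm_le exc0 y Yy; have [Yn /cvg_ex[l /= yl]] := Yy.
have near_pt n : exists z, Z z /\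
    mdist (y n) z < inf [set mdist (y n) z | z in Z] + 1.
  have imZ0 : [set mdist (y n) z | z in Z] !=set0 by exact/image_nonempty.
  have [_ [z Zz <-] yz] := inf_lt imZ0 (ltr_pwDr ltr01 (lexx _)).
  by exists z.
have [z zP] := choice near_pt.
have yz0 : mdist (y n) (z n) / r n @[n --> \oo] --> (0 : R).
  apply/cvgr0Pnorm_le => e e0.
  (* Eventually d(y_n, p) <= (|l| + 1) r_n, so this choice of [d] makes d * d(y_n, p) at most half
     of e * r_n; the constant [C] takes the other half. *)
  have L0 : 0 < `|l| + 1 by rewrite ltr_pwDr.
  have d0 : 0 < e / 2 / (`|l| + 1) by rewrite !divr_gt0.
  set d := e / 2 / (`|l| + 1) in d0.
  have [M [_ excM]] := exc0 _ d0.
  have [a Za] := Z0.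
  (* When d(y_n, p) <= |M|, the point [a] of [Z] is within |M| + d(p, a) of y_n; the 1 is the slack
     in choosing z_n. *)
  pose C := `|M| + mdist p a + 1.
  have infC n : mdist (y n) (z n) <= d * mdist (y n) p + C.
    apply: (le_trans (ltW (zP n).2)); rewrite /C addrA lerD2r.
    have yp0 := mdist_ge0 (y n) p; have pa0 := mdist_ge0 p a.
    have [Myp|ypM] := ltP `|M| (mdist (y n) p).
      have yp : 0 < mdist (y n) p by apply: le_lt_trans Myp.
      have := excM _ (le_lt_trans (ler_norm M) Myp).
      rewrite ger0_norm ?divr_ge0 ?excess_ge0// ler_pdivrMr// => exc.
      have := inf_mdist_le_excess p (y n) Y Z Z0 (Yn n).
      have := normr_ge0 M; lra.
    have := inf_mdist_le (y n) a Z Za.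
    have := metric_triangle (y n) p a.
    have : 0 <= d * mdist (y n) p by rewrite mulr_ge0// ltW.
    lra.
  have yL : \forall n \near \oo, mdist (y n) p / r n <= `|l| + 1.
    apply: (cvgr_le l yl); rewrite (le_lt_trans (ler_norm l))// ltrDl//.
  have Cr : \forall n \near \oo, C / (e / 2) <= r n.
    by move/cvgryPge : roo; exact.
  apply: filterS2 Cr yL => n Cr yL.
  rewrite ger0_norm ?divr_ge0 ?mdist_ge0 ?(ltW (r0 n))// ler_pdivrMr//.
  apply: (le_trans (infC n)).
  have : C <= e / 2 * r n by rewrite mulrC -ler_pdivrMr// divr_gt0.
  have : d * mdist (y n) p <= e / 2 * r n.
    rewrite ler_pdivrMr// in yL.
    rewrite (le_trans (ler_wpM2l (ltW d0) yL))// /d mulrA divfK// gt_eqF//.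
  lra.
exists z; last exact/seq_dist_eq0.
by apply: (Seq_close p Y Z r y z) => // n; exact: (zP n).1.
Qed.

(* If the ratio exceeded e along some t_n -> oo, points y_n of Y at distance t_n
   from p and more than e t_n / 2 from Z would form a sequence in
   Seq(Y, (t_n)) that no sequence of Z approximates. *)
Lemma approximable_excess_cvg0 p Y Z :
  (forall r, scaling_sequence r -> approximable p Y Z r) ->
  excess p t Y Z / t @[t --> +oo] --> (0 : R).
Proof.
move=> YZ; apply/cvgr0Pnorm_le => e e0; apply: contrapT => far.
have farn n : exists ty : R * X, [/\ n%:R < ty.1, Y ty.2, mdist ty.2 p = ty.1 &
    forall z, Z z -> e / 2 * ty.1 < mdist ty.2 z].
  move/not_near_inftyP : far => /(_ n%:R (num_real _))[t nt /negP].
  have t0 : 0 < t by apply: le_lt_trans nt.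
  rewrite -ltNge ger0_norm ?divr_ge0 ?excess_ge0 ?(ltW t0)//.
  rewrite ltr_pdivlMr// => et.
  have [||y [Yy yp yZ]] := excess_gt p t (e / 2 * t) Y Z.
  - by rewrite mulr_ge0 ?divr_ge0// ltW.
  - by rewrite (le_lt_trans _ et)// ler_pM2r//; lra.
  by exists (t, y).
have [ty tyP] := choice farn.
have t0 n : 0 < (ty n).1 by have [nt _ _ _] := tyP n; apply: le_lt_trans nt.
(* The radii exceed n, hence tend to infinity. *)
have scal : scaling_sequence (fun n => (ty n).1).
  split=> //; apply: ger_cvgy (@cvgr_idn R).
  by apply: nearW => n; have [/ltW] := tyP n.
have [|z [Zz _] /(seq_dist_eq0 _ _ _ t0)/cvgr0Pnorm_lt] :=
    YZ _ scal (fun n => (ty n).2).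
  split=> [n|]; first by have [] := tyP n.
  (* Here d(y_n, p) is the scale itself, so the ratio is constantly 1. *)
  apply/cvg_ex; exists 1 => /=.
  rewrite (_ : (fun _ => _) = cst 1); first exact: cvg_cst.
  by apply/funext => n /=; have [_ _ -> _] := tyP n; rewrite divff// gt_eqF.
move=> /(_ (e / 2) (divr_gt0 e0 (ltr0Sn _ 1)))[N _ /(_ N (leqnn N)) /=].
have [_ _ _ /(_ _ (Zz N)) yz] := tyP N.
rewrite ger0_norm ?divr_ge0 ?mdist_ge0 ?(ltW (t0 N))//.
by rewrite ltr_pdivrMr// => /(lt_trans yz); rewrite ltxx.
Qed.

(** A maximum of two nonnegative numbers lies between each of them and their sum. *)
Lemma epsilon_cvg0E p Y Z :
  epsilon p Y Z t / t @[t --> +oo] --> (0 : R) <->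
  excess p t Y Z / t @[t --> +oo] --> (0 : R) /\
  excess p t Z Y / t @[t --> +oo] --> (0 : R).
Proof.
have bound A B t : 0 < t -> excess p t A B <= epsilon p Y Z t ->
    0 <= excess p t A B / t <= epsilon p Y Z t / t.
  move=> t0 le_eps.
  by rewrite divr_ge0 ?excess_ge0 ?(ltW t0)//= ler_pM2r// invr_gt0.
split=> [eps0|[YZ ZY]].
  split; apply: squeeze_cvgr (cvg_cst 0) eps0; near=> t;
    by apply: bound; rewrite // /epsilon le_max lexx ?orbT.
have sum0 : excess p t Y Z / t + excess p t Z Y / t @[t --> +oo] --> (0 : R).
  by rewrite -[X in _ --> X](addr0 0); apply: cvgD.
apply: squeeze_cvgr (cvg_cst 0) sum0; near=> t; have t0 : 0 < t by [].
have := excess_ge0 p t Y Z; have := excess_ge0 p t Z Y => ZY0 YZ0.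
rewrite /= -mulrDl divr_ge0 ?ler_pM2r ?invr_gt0 ?(ltW t0)//=.
  by rewrite /epsilon ge_max lerDl lerDr YZ0.
by rewrite /epsilon le_max ZY0.
Unshelve. all: by end_near. Qed.

End OneSided.

Theorem theorem7p16 (R : realType) (X : metricType R) (p : X) (Y Z : set X)
    (hY : unbounded Y) (hZ : unbounded Z) :
  strongly_asymptotically_equivalent p Y Z <->
  epsilon p Y Z t / t @[t --> +oo] --> (0 : R).
Proof.
rewrite epsilon_cvg0E; split=> [sae|[YZ ZY] r scal].
  by split; apply: approximable_excess_cvg0 => r /sae
    /asymptotically_equivalentE[].
apply/asymptotically_equivalentE; split; apply: excess_cvg0_approximable => //;
  exact: unbounded_nonempty.
Qed.
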